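(* Let $E$ and $E'$ be real Banach spaces of dimension at least two and let $G\subsetneq E$, $G'\subsetneq E'$ be domains. Let $G$ be a $c$-John domain and let $f:\overline G\to\overline{G'}$ be a homeomorphism that is $\eta$-quasisymmetric relative to $\delta G$ and maps $G$ onto $G'$. If, further, $G'$ is $\psi$-natural, then $G'$ is a $c'$-John domain, where $c'=c'(c,\eta,\psi)$ depends only on $c$, $\eta$ and $\psi$.
   Context: A domain is an open connected set. The norm is written $|\cdot|$; $\delta G=\overline G\setminus G$ is the boundary of $G$, and $\delta_G(x)=\inf\{|x-y|:y\in\delta G\}$ for $x\in G$. A curve is a continuous map from a closed interval; it joins its endpoints. For points $u,v$ on a curve $\gamma$, $\gamma[u,v]$ is the part of $\gamma$ from $u$ to $v$, $l$ denotes length, $\mathrm{diam}$ denotes diameter and $\mathrm{dist}$ distance in the norm metric. For $c\ge 1$, a domain $G\subsetneq E$ is $c$-John (also called length $c$-John) if each pair of points $x_1,x_2\in G$ can be joined by a curve $\gamma$ in $G$ with $\min_{j=1,2} l(\gamma[x_j,x])\le c\,\delta_G(x)$ for all $x\in\gamma$. Quasisymmetry: a triple in a metric space $X$ is an ordered sequence $T=(x,y,z)$ of three distinct points, with ratio $\rho(T)=|y-x|/|z-x|$. For $A\subset X$, $T=(x,y,z)$ is a triple in the pair $(X,A)$ if $x\in A$ or $\{y,z\}\subset A$. Given a homeomorphism $\eta:[0,\infty)\to[0,\infty)$, an embedding $f:X\to Y$ of metric spaces is $\eta$-quasisymmetric relative to $A$ if $\rho(f(T))\le\eta(\rho(T))$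 for every triple $T$ in $(X,A)$, where $f(T)=(f(x),f(y),f(z))$. Here $X=\overline G$, $A=\delta G$. The quasihyperbolic length of a rectifiable arc $\gamma$ in a domain $G\subsetneq E$ is $l_k(\gamma)=\int_\gamma \frac{|dz|}{\delta_G(z)}$, and the quasihyperbolic distance is $k_G(x,y)=\inf_\gamma l_k(\gamma)$ over all rectifiable arcs $\gamma$ in $G$ joining $x$ and $y$. $\mathrm{diam}_k$ denotes diameter with respect to $k_G$. Let $\psi:[0,\infty)\to[0,\infty)$ be an increasing function. A domain $G\subsetneq E$ is $\psi$-natural if $\mathrm{diam}_k(A)\le\psi\left(\frac{\mathrm{diam}(A)}{\mathrm{dist}(A,\delta G)}\right)$ for every nonempty connected subset $A\subset G$ (the condition being vacuous when the quotient is not finite, i.e. when $A$ is unbounded or $\mathrm{dist}(A,\delta G)=0$). *)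

(* Defs.v *)
From HB Require Import structures.
From mathcomp Require Import all_boot all_order all_algebra.
From mathcomp Require Import all_classical all_reals all_analysis.
Set Implicit Arguments.
Unset Strict Implicit.
Unset Printing Implicit Defensive.
Import Order.TTheory GRing.Theory Num.Theory.
Import numFieldNormedType.Exports.
Local Open Scope classical_set_scope.
Local Open Scope ring_scope.

(* Maps between subsets are total functions whose values off the subset are
   irrelevant; subsets carry the subspace topology. *)
Definition homeomorphism (T U : topologicalType) (A : set T) (B : set U)
    (f : T -> U) : Prop :=
  [/\ set_bij A B f,
      {within A, continuous f} &
      exists2 g : U -> T, {within B, continuous g} &
        forall x, A x -> g (f x) = x].

Definition homeo_halfline (R : realType) (eta : R -> R) : Prop :=
  @homeomorphism R R [set t | 0 <= t] [set t | 0 <= t] eta.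

Definition increasing_halfline (R : realType) (psi : R -> R) : Prop :=
  (forall t, 0 <= t -> 0 <= psi t) /\
  (forall s t, 0 <= s -> s <= t -> psi s <= psi t).

Section Banach.
Context {R : realType} {E : completeNormedModType R}.
Implicit Types (G A : set E) (x y : E) (gamma : R -> E) (a b c t s : R).

Definition dim_ge2 : Prop :=
  exists u v : E, forall a b, a *: u + b *: v = 0 -> a = 0 /\ b = 0.

Definition domain G : Prop := open G /\ connected G.

Definition bdry G : set E := closure G `\` G.

Definition dist_bdry G x : R := inf [set `|x - y| | y in bdry G].

(* Real-valued; meaningful for bounded nonempty A. *)
Definition diameter A : R := sup [set `|x - y| | x in A & y in A].

Definition dist A (B : set E) : R := inf [set `|x - y| | x in A & y in B].

(* A degenerate parameter interval (a = b) is allowed. *)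
Definition curve_in G gamma a b x y : Prop :=
  [/\ a <= b, {within `[a, b], continuous gamma},
      forall t, a <= t <= b -> G (gamma t), gamma a = x & gamma b = y].

(* A partition s of [a, b] lists its points other than a in increasing order;
   for a = b the only one is [::], with sum 0. *)
Definition curve_length gamma a b : \bar R :=
  ereal_sup [set (\sum_(0 <= i < size s)
      `|gamma (nth b (a :: s) i.+1) - gamma (nth b (a :: s) i)|)%:E
    | s in [set s : seq R | itv_partition a b s]].

Definition John c G : Prop :=
  forall x1 x2, G x1 -> G x2 ->
  exists gamma a b, curve_in G gamma a b x1 x2 /\
    forall t, a <= t <= b ->
      (Order.min (curve_length gamma a t) (curve_length gamma t b)
        <= (c * dist_bdry G (gamma t))%:E)%E.

Definition rectifiable_arc_in G gamma a b x y : Prop :=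
  [/\ curve_in G gamma a b x y,
      (forall t s, a <= t <= b -> a <= s <= b -> gamma t = gamma s -> t = s) &
      (curve_length gamma a b < +oo)%E].

(* The arclength parametrization of gamma on [a, b], for s between 0 and the
   length of gamma: the point reached when length s has been travelled. *)
Definition arclength_param gamma a b s : E :=
  gamma (inf [set t | a <= t <= b /\ (s%:E <= curve_length gamma a t)%E]).

Definition qh_length G gamma a b : \bar R :=
  (\int[lebesgue_measure]_(s in `[0%R, fine (curve_length gamma a b)])
     ((dist_bdry G (arclength_param gamma a b s))^-1)%:E)%E.

Definition qh_dist G x y : \bar R :=
  ereal_inf [set l | exists gamma a b,
    rectifiable_arc_in G gamma a b x y /\ l = qh_length G gamma a b].

Definition qh_diameter G A : \bar R :=
  ereal_sup [set qh_dist G x y | x in A & y in A].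

Definition natural (psi : R -> R) G : Prop :=
  forall A, A !=set0 -> connected A -> A `<=` G ->
    bounded_set A -> 0 < dist A (bdry G) ->
    (qh_diameter G A <= (psi (diameter A / dist A (bdry G)))%:E)%E.

End Banach.
Arguments dim_ge2 {R} E.

Section Quasisymmetry.
Context {R : realType} {E E' : completeNormedModType R}.
Implicit Types (X A : set E) (f : E -> E') (x y z : E) (eta : R -> R).

Definition ratio (V : completeNormedModType R) (x y z : V) : R :=
  `|y - x| / `|z - x|.

Definition triple_in X A x y z : Prop :=
  [/\ X x, X y & X z] /\ [/\ x <> y, y <> z & x <> z] /\
  (A x \/ (A y /\ A z)).

Definition quasisymmetric_rel eta X A f : Prop :=
  homeomorphism X (f @` X) f /\
  forall x y z, triple_in X A x y z ->
    ratio (f x) (f y) (f z) <= eta (ratio x y z).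

End Quasisymmetry.

(* Main.v *)
Require Import Defs.
From mathcomp Require Import all_boot all_order all_algebra.
From mathcomp Require Import all_classical all_reals all_analysis.
From mathcomp Require Import ring lra.
Set Implicit Arguments.
Unset Strict Implicit.
Unset Printing Implicit Defensive.
Import Order.TTheory GRing.Theory Num.Theory.
Import numFieldNormedType.Exports.
Local Open Scope classical_set_scope.
Local Open Scope ring_scope.

(** The length John condition cannot be transported by [f] directly, because [f]
does not control lengths. Distances to the end of a curve can be transported,
and naturality of the target then turns them back into lengths.

Let [g] be a [c]-John curve from [x1] to [x2]. Cutting it where the two
subarcs have equal length gives, on each half, the distance condition
[|g s - g t| <= c * d(g t)], where [s] lies between [t] and the end of the half
([John_distance_carrots]). If [u] and [x] are such points and [b] lies on the
boundary of [G], then [|u - b| <= (c + 1) |x - b|], and relative quasisymmetry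
for the triple [(b, u, x)] gives [|f u - f b| <= H |f x - f b|] with [H] the
maximum of [eta] on [[0, c + 1]]. Taking the infimum over [b], the points [f u]
and [f x] satisfy the distance condition with constant [C = 1 + H]
([quasisymmetric_dist_le]).

It remains to replace each half of the image curve by one whose initial pieces
are short compared with the boundary distance ([distance_to_length_carrot]). Let
[d] be the boundary distance at the starting point, and cut the half at the last
times at which the boundary distance is [2 ^ n * d]. On the piece between two
such times the boundary distance is at least [2 ^ n * d] and the diameter is at
most a multiple of [2 ^ n * d], so by naturality the endpoints of the piece are
joined by an arc of quasihyperbolic length less than a constant [L]. Along an arc
of quasihyperbolic length [L] the boundary distance falls by a factor of at most
[expR L], and the length of the arc is at most [expR L] times the boundary
distance at its start ([qh_length_bounds]): both come from integrating
[1 / (m + s)], as the boundary distance is 1-Lipschitz. Concatenating the arcs,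
the lengths form a geometric series dominated by its last term, which is
comparable with the boundary distance on the last arc. *)

(** * Length of curves *)

Section CurveLength.
Context {R : realType} {E : completeNormedModType R}.
Implicit Types (g : R -> E) (a b c t : R) (s : seq R).

(** The polygonal sums that define [curve_length], by recursion on the partition,
so that its properties follow by induction. *)
Fixpoint chain_sum g a s : R :=
  if s is x :: s' then `|g x - g a| + chain_sum g x s' else 0.

Lemma chain_sumE g a b s :
  \sum_(0 <= i < size s) `|g (nth b (a :: s) i.+1) - g (nth b (a :: s) i)|
  = chain_sum g a s.
Proof.
elim: s a => [a|x s IH a] /=; first by rewrite big_nil.
by rewrite big_nat_recl//= -IH.
Qed.

Lemma chain_sum_le_length g a b s : itv_partition a b s ->
  ((chain_sum g a s)%:E <= curve_length g a b)%E.
Proof.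
by move=> sP; apply: ereal_sup_ubound; exists s => //=; rewrite chain_sumE.
Qed.

Lemma length_le g a b (l : \bar R) :
  (forall s, itv_partition a b s -> ((chain_sum g a s)%:E <= l)%E) ->
  (curve_length g a b <= l)%E.
Proof.
move=> H; apply: ge_ereal_sup => _ /= [s sP <-].
by rewrite chain_sumE; exact: H.
Qed.

Lemma itv_partition_consI a b x s : a < x -> itv_partition x b s ->
  itv_partition a b (x :: s).
Proof. by move=> ax [xs sb]; split => //=; rewrite ax. Qed.

Lemma itv_partition_consE a b x s : itv_partition a b (x :: s) ->
  a < x /\ itv_partition x b s.
Proof. by move=> [/= /andP[ax xs] sb]. Qed.

Lemma length_cons g a x b : a <= x -> x <= b ->
  (`|g x - g a|%:E + curve_length g x b <= curve_length g a b)%E.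
Proof.
rewrite le_eqVlt => /predU1P[->|ax] xb; first by rewrite subrr normr0 add0e.
rewrite -leeBrDl//; apply: length_le => s sP; rewrite leeBrDl// -EFinD.
exact: (chain_sum_le_length _ (itv_partition_consI ax sP)).
Qed.

Lemma length_refl g a : curve_length g a a = 0%E.
Proof.
apply/eqP; rewrite eq_le; apply/andP; split.
  by apply: length_le => s /itv_partitionxx ->.
by apply: (@chain_sum_le_length _ _ _ [::]); split => /=.
Qed.

Lemma length_ge0 g a b : a <= b -> (0 <= curve_length g a b)%E.
Proof.
move=> ab; apply: le_trans (@length_cons g a b b ab (lexx b)).
by rewrite length_refl adde0 lee_fin.
Qed.

Lemma length_rcons g a x b : a <= x -> x <= b ->
  (curve_length g a x + `|g b - g x|%:E <= curve_length g a b)%E.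
Proof.
move=> ax; rewrite le_eqVlt => /predU1P[<-|xb].
  by rewrite subrr normr0 adde0.
rewrite -leeBrDr//; apply: length_le => s sP; rewrite leeBrDr// -EFinD.
suff -> : chain_sum g a s + `|g b - g x| = chain_sum g a (rcons s b).
  apply: chain_sum_le_length; case: sP => sP /eqP sx.
  by split; rewrite ?last_rcons// rcons_path sP sx.
case: sP => _ /eqP <-; elim: s {ax} a => [a|y s IH a] /=.
  by rewrite addr0 add0r.
by rewrite -addrA IH.
Qed.

Lemma length_ler g a x b : a <= x -> x <= b ->
  (curve_length g a x <= curve_length g a b)%E.
Proof.
by move=> ax xb; apply: le_trans (@length_rcons g _ _ _ ax xb); rewrite leeDl.
Qed.

Lemma length_lel g a x b : a <= x -> x <= b ->
  (curve_length g x b <= curve_length g a b)%E.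
Proof.
by move=> ax xb; apply: le_trans (@length_cons g _ _ _ ax xb); rewrite leeDr.
Qed.

Lemma dist_le_length g a b t u : a <= t -> t <= u -> u <= b ->
  (`|g u - g t|%:E <= curve_length g a b)%E.
Proof.
move=> at_ tu ub; apply: le_trans (@length_lel g _ _ _ at_ (le_trans tu ub)).
apply: le_trans (@length_ler g _ _ _ tu ub).
apply: le_trans (@length_rcons g _ _ _ (lexx t) tu).
by rewrite length_refl add0e.
Qed.

(** If the cut point [c] is not in the partition, inserting it into the interval
that contains it increases the sum. *)
Lemma length_cat g a c b : a <= c -> c <= b ->
  (curve_length g a b <= curve_length g a c + curve_length g c b)%E.
Proof.
move=> ac cb; apply: length_le => s; elim: s a ac => [|x s IH] a ac.
  by move=> _; rewrite adde_ge0// length_ge0.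
move=> /itv_partition_consE [ax sP] /=; have [xc|cx] := leP x c.
  rewrite EFinD; apply: le_trans (leeD (lexx _) (IH x xc sP)) _.
  by rewrite addeA; apply: leeD => //; exact: length_cons (ltW ax) xc.
apply: (@le_trans _ _ ((`|g c - g a| + `|g x - g c| + chain_sum g x s)%:E)).
  by rewrite lee_fin lerD2r [leRHS]addrC ler_distD.
rewrite -addrA EFinD; apply: leeD.
  exact: dist_le_length.
exact: (chain_sum_le_length _ (itv_partition_consI cx sP)).
Qed.

Lemma eq_length g h a b : (forall t, a <= t <= b -> g t = h t) ->
  (curve_length g a b <= curve_length h a b)%E.
Proof.
move=> gh; apply: length_le => s sP.
suff -> : chain_sum g a s = chain_sum h a s by exact: chain_sum_le_length.
elim: s a gh sP => [//|x s IH] a gh /itv_partition_consE [ax sP] /=.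
have xb := itv_partition_le sP.
rewrite !gh ?lexx ?(ltW ax) ?(le_trans (ltW ax))// (IH x)// => t /andP[xt tb].
by apply: gh; rewrite tb (le_trans (ltW ax)).
Qed.

Lemma length_comp_incr g (p : R -> R) a b : {homo p : t u / t < u} ->
  (curve_length (g \o p) a b <= curve_length g (p a) (p b))%E.
Proof.
move=> pi; apply: length_le => s sP.
have -> : chain_sum (g \o p) a s = chain_sum g (p a) (map p s).
  by elim: s a {sP} => //= x s IH a; rewrite IH.
apply: chain_sum_le_length; elim: s a sP => [a /itv_partition_nil ->|x s IH a].
  by split => /=.
move=> /itv_partition_consE [ax sP]; apply: itv_partition_consI; last exact: IH.
exact: pi.
Qed.

Lemma length_comp_decr g (p : R -> R) a b : {homo p : t u /~ t < u} ->
  (curve_length (g \o p) a b <= curve_length g (p b) (p a))%E.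
Proof.
move=> pd; apply: length_le => s; elim: s a => [|x s IH] a sP.
  by move: sP => /itv_partition_nil ->; rewrite length_refl.
move: sP => /itv_partition_consE [ax sP] /=; rewrite addrC EFinD.
apply: le_trans (leeD (IH x sP) (lexx _)) _; rewrite distrC.
apply: length_rcons; last exact: ltW (pd _ _ ax).
by apply: (ltW_nhomo pd); exact: itv_partition_le sP.
Qed.

End CurveLength.

(** * Distance to the boundary *)

Section BoundaryDistance.
Context {R : realType} {E : completeNormedModType R}.
Implicit Types (G : set E) (x y : E) (r : R).

(** A nonempty proper open set with empty boundary would be clopen, and so would
be its trace on a segment that leaves it. The point of the lemma is that
[dist_bdry] is then the infimum of a nonempty set. *)
Lemma bdry_neq0 G : open G -> G !=set0 -> G != setT -> bdry G !=set0.
Proof.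
move=> oG [x Gx]; apply: contra_neqP => /set0P/negP/negPn/eqP bG0.
rewrite -subTset => y _.
have cG : closure G `<=` G by rewrite -setD_eq0.
pose p (t : R) := x + t *: (y - x).
have cp : continuous p.
  move=> t; apply: cvgD; first exact: cvg_cst.
  by apply: cvgZ; [exact: cvg_id|exact: cvg_cst].
have clG : closed G by move=> z /cG.
suff /seteqP[_ /(_ 1)] : `[0, 1] `&` p @^-1` G = `[0%R, 1%R]%classic.
  rewrite /= in_itv/= ler01 lexx => /(_ isT)[_].
  by rewrite /p scale1r addrC subrK.
apply: (@segment_connected R 0 1).
- by exists 0; split; rewrite /= ?in_itv/= ?lexx ?ler01// /p scale0r addr0.
- by exists (p @^-1` G) => //; apply: open_comp => // t _; exact: cp.
- by exists (p @^-1` G) => //; apply: closed_comp => // t _; exact: cp.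
Qed.

Lemma dist_bdry_le G x y : bdry G y -> dist_bdry G x <= `|x - y|.
Proof.
by move=> bGy; apply: ge_inf; [exists 0 => _ [z _ <-]|exists y].
Qed.

Lemma dist_bdry_ge G x r : bdry G !=set0 ->
  (forall y, bdry G y -> r <= `|x - y|) -> r <= dist_bdry G x.
Proof.
move=> [y bGy] H; apply: lb_le_inf; first by exists `|x - y|, y.
by move=> _ [z bGz <-]; exact: H.
Qed.

Lemma dist_bdry_gt0 G x : open G -> bdry G !=set0 -> G x -> 0 < dist_bdry G x.
Proof.
move=> oG bG0 Gx; have /nbhs_ballP[r /= r0 rG] := open_nbhs_nbhs (conj oG Gx).
apply: (lt_le_trans r0); apply: dist_bdry_ge => // y [_ nGy].
by rewrite leNgt; apply/negP => xy; apply/nGy/rG; rewrite -ball_normE.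
Qed.

Lemma dist_bdry_lip G x y : bdry G !=set0 ->
  dist_bdry G x <= `|x - y| + dist_bdry G y.
Proof.
move=> bG0; rewrite -lerBlDl; apply: dist_bdry_ge => // z bGz.
by rewrite lerBlDl (le_trans (dist_bdry_le _ bGz))// ler_distD.
Qed.

Lemma dist_bdry_continuous G : bdry G !=set0 -> continuous (dist_bdry G).
Proof.
move=> bG0 x; apply/cvgrPdist_lt => e e0.
near=> y; apply: (@le_lt_trans _ _ `|x - y|).
  rewrite ler_norml lerBlDr dist_bdry_lip// andbT lerNl opprB lerBlDr.
  by rewrite distrC dist_bdry_lip.
by near: y; move/cvgrPdist_lt : (@cvg_id _ (nbhs x)); apply.
Unshelve. all: by end_near. Qed.

End BoundaryDistance.

(** * Continuity of curves *)

Section Curves.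
Context {R : realType}.
Implicit Types (a b t : R).

Lemma ge0_closure_itv (h : R -> R) p q : continuous h -> p < q ->
  (forall t, p < t < q -> 0 <= h t) -> 0 <= h p /\ 0 <= h q.
Proof.
move=> ch pq H; split.
  apply: (@cvgr_to_ge _ (p^'+) _ _ h (h p)).
    by apply: cvg_at_right_filter; exact: ch.
  near=> t; apply: H; apply/andP; split; near: t.
    exact: nbhs_right_gt.
  exact: nbhs_right_lt.
apply: (@cvgr_to_ge _ (q^'-) _ _ h (h q)).
  by apply: cvg_at_left_filter; exact: ch.
near=> t; apply: H; apply/andP; split; near: t.
  exact: nbhs_left_gt.
exact: nbhs_left_lt.
Unshelve. all: by end_near. Qed.

(** Composing with [clamp a b] extends a curve on [[a, b]] to a continuous
function on the whole line with the same points. *)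
Definition clamp a b t := Order.max a (Order.min b t).

Lemma clamp_id a b t : a <= t <= b -> clamp a b t = t.
Proof. by move=> /andP[at_ tb]; rewrite /clamp min_r// max_r. Qed.

Lemma clamp_itv a b t : a <= b -> a <= clamp a b t <= b.
Proof. by move=> ab; rewrite /clamp le_max lexx/= ge_max ab ge_min lexx. Qed.

Lemma clamp_continuous a b : continuous (clamp a b).
Proof.
move=> t; apply: continuous_max; first exact: cvg_cst.
by apply: continuous_min; [exact: cvg_cst|exact: cvg_id].
Qed.

Lemma comp_within_continuous (S T U : topologicalType) (A : set T)
    (f : T -> U) (p : S -> T) : {within A, continuous f} -> continuous p ->
  (forall s, A (p s)) -> continuous (f \o p).
Proof.
move=> cf cp pA s V /= VP; have := cf (p s) _ VP.
rewrite /nbhs/= -nbhs_subspace_in; last exact: pA.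
move=> /(cp s); apply: (@filterS _ _ (nbhs_filter s)) => u /= Vu.
exact: (Vu (pA u)).
Qed.

Lemma within_continuous_clamp (T : topologicalType) (g : R -> T) a b :
  a <= b -> {within `[a, b], continuous g} ->
  continuous (g \o clamp a b) /\
  forall t, a <= t <= b -> (g \o clamp a b) t = g t.
Proof.
move=> ab cg; split; last by move=> t tab /=; rewrite clamp_id.
apply: comp_within_continuous cg _ _; first exact: clamp_continuous.
by move=> t; rewrite /= in_itv/= clamp_itv.
Qed.

End Curves.

(** * Quasihyperbolic length *)

Section LogarithmicIntegrals.
Context {R : realType}.
Implicit Types (h : R -> R) (k l m q L : R).

(** The integral of a nonnegative function is a supremum over the simple
functions below it, hence monotone for arbitrary integrands. *)
Lemma integral_mono_ge0 (D D' : set R) (f g : R -> \bar R) : D `<=` D' ->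
  (forall s, D s -> (0 <= f s)%E) -> (forall s, D' s -> (0 <= g s)%E) ->
  (forall s, D s -> (f s <= g s)%E) ->
  (\int[lebesgue_measure]_(s in D) f s <=
   \int[lebesgue_measure]_(s in D') g s)%E.
Proof.
move=> DD' f0 g0 fg; rewrite !ge0_integralE//.
apply: ereal_sup_le => _ /= [u uf <-]; exists u => // s.
apply: (le_trans (uf s)); rewrite /patch; case: ifPn => [/set_mem Ds|_].
  by rewrite mem_set ?fg//; exact: DD'.
by case: ifPn => // /set_mem /g0.
Qed.

(** The slope is [k = 1] or [k = -1]; in both cases [k * ln (m + k * s)] is a
primitive, because [k * k = 1]. *)
Lemma integral_inv_affine m k q : k * k = 1 -> 0 < q ->
  (forall s, 0 <= s <= q -> 0 < m + k * s) ->
  (\int[lebesgue_measure]_(s in `[0%R, q]) ((m + k * s)^-1)%:E =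
   (k * (ln (m + k * q) - ln m))%:E)%E.
Proof.
move=> kk q0 pos; pose F : R -> R := fun s => k * ln (m + k * s).
have dF s : 0 <= s <= q -> is_derive s 1 F (m + k * s)^-1.
  move=> /pos ps.
  have -> : F = k \*: (@ln R \o (fun s => m + k * s)) by [].
  have du : is_derive s (1 : R) (fun s => m + k * s) (0 + k * 1).
    have -> : (fun s => m + k * s) = (cst m + (k \*: (@id R)))%R by [].
    exact: is_deriveD.
  have := is_deriveZ k (@is_derive1_comp _ (@ln R)
    (fun s => m + k * s) _ _ _ (is_derive1_ln ps) du).
  by rewrite add0r mulr1 /GRing.scale/= mulrCA kk mulr1.
have cF s : 0 <= s <= q -> {for s, continuous F}.
  by move=> /dF dFs; apply/differentiable_continuous/derivable1_diffP.
rewrite (@continuous_FTC2 _ _ F)//; last 3 first.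
- apply: continuous_in_subspaceT => s; rewrite inE/= in_itv/= => /pos ps.
  apply: cvgV; first by rewrite gt_eqF.
  by apply: cvgD; [exact: cvg_cst|apply: cvgM; [exact: cvg_cst|exact: cvg_id]].
- split.
  + move=> s; rewrite in_itv/= => /andP[/ltW s0 /ltW sq].
    by have := dF s; rewrite s0 sq => /(_ isT) ds; exact: ex_derive.
  + by apply: cvg_at_right_filter; apply: cF; rewrite lexx ltW.
  + by apply: cvg_at_left_filter; apply: cF; rewrite lexx ltW.
- move=> s; rewrite in_itv/= => /andP[/ltW s0 /ltW sq].
  by have := dF s; rewrite s0 sq derive1E => /(_ isT) ds; exact: derive_val.
by rewrite /F mulr0 addr0 -EFinB mulrBr.
Qed.

(** With [h] the inverse of the boundary distance along an arc, [k = 1] measures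
from the start of the arc and [k = -1] measures back from a later point. *)
Lemma log_growth_bound m k q l h L : k * k = 1 -> 0 <= q <= l ->
  (forall s, 0 <= s <= q -> 0 < m + k * s) ->
  (forall s, 0 <= s <= l -> 0 <= h s) ->
  (forall s, 0 <= s <= q -> (m + k * s)^-1 <= h s) ->
  (\int[lebesgue_measure]_(s in `[0%R, l]) (h s)%:E <= L%:E)%E ->
  k * (ln (m + k * q) - ln m) <= L.
Proof.
move=> kk /andP[q0 ql] pos h0 hq hL; rewrite -lee_fin; apply: le_trans hL.
move: q0; rewrite le_eqVlt => /predU1P[q0|q0].
  rewrite -q0 mulr0 addr0 subrr mulr0.
  by apply: integral_ge0 => s /=; rewrite in_itv/= lee_fin => /h0.
rewrite -integral_inv_affine//; apply: integral_mono_ge0 => s /=.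
- by rewrite !in_itv/= => /andP[-> /le_trans]; apply.
- by rewrite in_itv/= lee_fin invr_ge0 => /pos/ltW.
- by rewrite in_itv/= lee_fin => /h0.
- by rewrite in_itv/= lee_fin => /hq.
Qed.

End LogarithmicIntegrals.

Section QuasihyperbolicArcs.
Context {R : realType} {E : completeNormedModType R}.
Implicit Types (G : set E) (g : R -> E) (a b s t L : R) (x y : E).

Definition reach g a b s : set R :=
  [set t | a <= t <= b /\ (s%:E <= curve_length g a t)%E].

Lemma reach_inf_itv g a b s t : reach g a b s t -> a <= inf (reach g a b s) <= t.
Proof.
move=> rt; apply/andP; split.
  by apply: lb_le_inf; [exists t|move=> u [/andP[]]].
by apply: ge_inf => //; exists a => u [/andP[]].
Qed.

(** Before the first time [T] at which length [s] has been travelled, the curve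
is within [s] of its start; by continuity so it is at [T]. *)
Lemma arclength_param_start g a b s t : {within `[a, b], continuous g} -> 0 <= s ->
  reach g a b s t -> `|arclength_param g a b s - g a| <= s.
Proof.
move=> cg s0 rt; have tb : t <= b by case: rt => /andP[].
have /andP[aT Tt] := reach_inf_itv rt.
rewrite /arclength_param -/(reach g a b s); set T := inf _ in aT Tt *.
move: aT; rewrite le_eqVlt => /predU1P[<-|aT]; first by rewrite subrr normr0.
have ab : a <= b := le_trans (ltW aT) (le_trans Tt tb).
have [cp pg] := within_continuous_clamp ab cg.
rewrite -subr_ge0 -(pg T) ?(ltW aT) ?(le_trans Tt)//.
have [] // :=
  @ge0_closure_itv _ (fun t => s - `|(g \o clamp a b) t - g a|) _ _ _ aT.
  move=> u; apply: cvgB; first exact: cvg_cst.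
  by apply: cvg_norm; apply: cvgB; [exact: cp|exact: cvg_cst].
move=> u /andP[au uT].
rewrite pg ?(ltW au) ?(le_trans (ltW uT)) ?(le_trans Tt)// subr_ge0 -lee_fin.
apply: (le_trans (@dist_le_length _ _ g _ _ _ _ (lexx a) (ltW au) (lexx u))).
rewrite leNgt; apply/negP => /ltW su; move: (uT); rewrite ltNge => /negP; apply.
apply: ge_inf; first by exists a => v [/andP[]].
split=> //; rewrite (ltW au)/=; exact: le_trans (ltW uT) (le_trans Tt tb).
Qed.

(** Immediately after the first time [T] at which length [s] has been travelled,
at most [q - s] of the length up to time [t] remains; the bound passes to [T] by
continuity of the curve. *)
Lemma arclength_param_dist g a b s t q : {within `[a, b], continuous g} -> a <= t <= b ->
  curve_length g a t = q%:E -> s <= q ->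
  `|arclength_param g a b s - g t| <= q - s.
Proof.
move=> cg atb lq sq.
have rt : reach g a b s t by split => //; rewrite lq lee_fin.
have /andP[aT Tt] := reach_inf_itv rt.
rewrite /arclength_param -/(reach g a b s); set T := inf _ in aT Tt *.
move: Tt; rewrite le_eqVlt => /predU1P[->|Tt].
  by rewrite subrr normr0 subr_ge0.
have /andP[a_t tb] := atb; have ab := le_trans a_t tb.
have [cp pg] := within_continuous_clamp ab cg.
rewrite -subr_ge0 -(pg T) ?aT ?(le_trans (ltW Tt))//.
have [] // :=
  @ge0_closure_itv _ (fun u => q - s - `|(g \o clamp a b) u - g t|) _ _ _ Tt.
  move=> u; apply: cvgB; first exact: cvg_cst.
  by apply: cvg_norm; apply: cvgB; [exact: cp|exact: cvg_cst].
move=> u /andP[Tu ut].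
have [|v [/andP[av vb] sv] vu] := @inf_lt _ (reach g a b s) u _ Tu.
  by exists t.
have au : a <= u := le_trans av (ltW vu).
rewrite pg ?au ?(le_trans (ltW ut))//.
rewrite subr_ge0 lerBrDl distrC -lee_fin EFinD -lq.
apply: le_trans (@length_rcons _ _ g _ _ _ au (ltW ut)).
apply: leeD => //; apply: (le_trans sv); exact: length_ler av (ltW vu).
Qed.

End QuasihyperbolicArcs.

Section QuasihyperbolicBounds.
Context {R : realType} {E : completeNormedModType R}.
Implicit Types (G A : set E) (g : R -> E) (a b s t L : R) (x y : E).

Lemma ln_sub_le (u v L : R) : 0 < u -> 0 < v -> ln u - ln v <= L ->
  u <= expR L * v.
Proof.
move=> u0 v0; rewrite lerBlDr => H.
by rewrite -[leLHS](lnK u0) -[X in _ <= _ * X](lnK v0) -expRD ler_expR.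
Qed.

(** The boundary distance at arclength [s] is at most [d(g a) + s], so [L] is at
least [ln (1 + l / d(g a))] for the total length [l]. It is also at most
[d(g t) + (q - s)] if [g t] is reached at arclength [q], so [L] is at least
[ln (1 + q / d(g t))], while [d(g a) <= d(g t) + q]. *)
Lemma qh_length_bounds G g a b L : open G -> bdry G !=set0 -> a <= b ->
  {within `[a, b], continuous g} -> (forall t, a <= t <= b -> G (g t)) ->
  (curve_length g a b < +oo)%E -> (qh_length G g a b <= L%:E)%E ->
  (curve_length g a b <= (expR L * dist_bdry G (g a))%:E)%E /\
  forall t, a <= t <= b -> dist_bdry G (g a) <= expR L * dist_bdry G (g t).
Proof.
move=> oG bG0 ab cg Gg lfin; rewrite /qh_length.
have dG t : a <= t <= b -> 0 < dist_bdry G (g t).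
  by move=> /Gg; exact: dist_bdry_gt0.
have fin t : a <= t <= b ->
    exists2 q, curve_length g a t = q%:E & 0 <= q <= fine (curve_length g a b).
  move=> /andP[a_t tb]; have l0 := @length_ge0 _ _ g _ _ a_t.
  have ltb := @length_ler _ _ g _ _ _ a_t tb.
  have lt : curve_length g a t \is a fin_num.
    by rewrite ge0_fin_numE// (le_lt_trans ltb).
  exists (fine (curve_length g a t)); first by rewrite fineK.
  rewrite fine_ge0//= fine_le// ge0_fin_numE//; exact: le_trans ltb.
have bab : a <= b <= b by rewrite ab lexx.
have [l ll] := fin _ bab; rewrite ll/= => /andP[l0 _]; rewrite ll/= in fin.
(* The inverse of a vanishing distance would be zero, so the parametrization
   has to stay in G. *)
have hitv s : 0 <= s <= l -> exists2 t, a <= t <= b &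
    arclength_param g a b s = g t.
  move=> /andP[s0 sl].
  have slb : (s%:E <= curve_length g a b)%E by rewrite ll lee_fin.
  have /andP[aT Tb] := @reach_inf_itv _ _ g a b s b (conj bab slb).
  by exists (inf (reach g a b s)); rewrite ?aT.
have h0 s : 0 <= s <= l -> 0 < dist_bdry G (arclength_param g a b s).
  by move=> /hitv[t + ->]; exact: dG.
move=> hL.
have key k m q : k * k = 1 -> 0 <= q <= l ->
    (forall s, 0 <= s <= q ->
      dist_bdry G (arclength_param g a b s) <= m + k * s) ->
    k * (ln (m + k * q) - ln m) <= L.
  move=> kk qP dm; have /andP[q0 ql] := qP.
  have sl s : 0 <= s <= q -> 0 <= s <= l.
    by move=> /andP[-> /le_trans]; apply.
  apply: log_growth_bound hL => // [s sq|s sP|s sq].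
  - by apply: lt_le_trans (dm s sq); exact: h0 (sl _ sq).
  - by rewrite invr_ge0 ltW// h0.
  - rewrite lef_pV2 ?posrE; [exact: dm|exact: lt_le_trans (h0 _ (sl _ sq)) (dm _ sq)|].
    exact: h0 (sl _ sq).
split.
  rewrite lee_fin; have da : 0 < dist_bdry G (g a) by rewrite dG// lexx.
  have := key 1 (dist_bdry G (g a)) l; rewrite !mul1r lexx l0 => /(_ erefl isT).
  move=> H; apply: (@le_trans _ _ (dist_bdry G (g a) + l)); first by rewrite lerDr ltW.
  apply: ln_sub_le => //; first by rewrite ltr_wpDr.
  apply: H => s /andP[s0 sl]; rewrite mul1r addrC.
  apply: le_trans (dist_bdry_lip _ (g a) bG0) _; rewrite lerD2r.
  apply: (@arclength_param_start _ _ _ _ _ _ b) => //.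
  by split; rewrite ?bab// ll lee_fin.
move=> t tab; have [q lq qP] := fin _ tab; have /andP[q0 ql] := qP.
have /andP[a_t tb] := tab; have dt := dG _ tab.
have := key (-1) (dist_bdry G (g t) + q) q; rewrite mulrNN mulr1 => /(_ erefl qP).
rewrite !mulN1r addrK opprB => H.
apply: (@le_trans _ _ (dist_bdry G (g t) + q)).
  apply: le_trans (dist_bdry_lip _ (g t) bG0) _; rewrite addrC lerD2l.
  by rewrite distrC -lee_fin -lq; exact: dist_le_length.
apply: ln_sub_le => //; first by rewrite ltr_wpDr.
apply: H => s /andP[s0 sq]; rewrite mulN1r -addrA addrC.
apply: le_trans (dist_bdry_lip _ (g t) bG0) _; rewrite lerD2r.
exact: arclength_param_dist.
Qed.

End QuasihyperbolicBounds.

(** * Short arcs from naturality *)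

Section LengthCarrots.
Context {R : realType} {E : completeNormedModType R}.
Implicit Types (G A : set E) (g h : R -> E) (a b s t r D K L l C : R) (x y : E).

(** Adding the two curves, each frozen at time [b] on the other's side, gives
continuity without a case distinction. *)
Lemma glue_curves g h b : continuous g -> continuous h -> g b = h b ->
  exists k : R -> E, [/\ continuous k, forall t, t <= b -> k t = g t &
    forall t, b <= t -> k t = h t].
Proof.
move=> cg ch ghb.
exists (fun t => g (Order.min t b) + h (Order.max t b) - g b); split.
- move=> t; apply: cvgB; last exact: cvg_cst.
  apply: cvgD.
    apply: (@continuous_comp _ _ _ (fun t => Order.min t b) g); last exact: cg.
    by apply: continuous_min; [exact: cvg_id|exact: cvg_cst].
  apply: (@continuous_comp _ _ _ (fun t => Order.max t b) h); last exact: ch.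
  by apply: continuous_max; [exact: cvg_id|exact: cvg_cst].
- by move=> t tb; rewrite min_l// max_r// ghb addrK.
- by move=> t bt; rewrite min_r// max_l// addrAC subrr add0r.
Qed.

(** What remains of a bound on the quasihyperbolic distance of [x] and [y]. *)
Definition short_arc G K x y := exists g b,
  [/\ 0 <= b, continuous g, g 0 = x, g b = y &
    (curve_length g 0%R b <= (K * dist_bdry G x)%:E)%E /\
    forall t, 0 <= t <= b -> G (g t) /\ dist_bdry G x <= K * dist_bdry G (g t)].

(** Naturality is applied to the connected set [g @` [a, b]], for which the
quotient of diameter and boundary distance is at most [D / r]. *)
Lemma natural_short_arc (psi : R -> R) G g a b r D L :
  increasing_halfline psi -> open G -> bdry G !=set0 -> natural psi G ->
  a <= b -> continuous g -> (forall t, a <= t <= b -> G (g t)) -> 0 < r ->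
  (forall t, a <= t <= b -> r <= dist_bdry G (g t)) ->
  (forall s t, a <= s <= b -> a <= t <= b -> `|g s - g t| <= D) ->
  psi (D / r) < L -> short_arc G (expR L) (g a) (g b).
Proof.
move=> [_ psi_mono] oG bG0 nG ab cg Gg r0 rd diam psiL.
pose A := g @` `[a, b].
have Aab t : a <= t <= b -> A (g t) by move=> tab; exists t; rewrite //= in_itv.
have aab : a <= a <= b by rewrite lexx.
have bab : a <= b <= b by rewrite lexx ab.
have distA : r <= dist A (bdry G).
  apply: lb_le_inf => [|_ [_ [t + <-]] [z bGz <-]].
    by case: bG0 => z bGz; exists `|g a - z|, (g a); [exact: Aab|exists z].
  by rewrite /= in_itv/= => /rd /le_trans; apply; exact: dist_bdry_le.
have diamA : 0 <= diameter A <= D.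
  have ubD : ubound [set `|x - y| | x in A & y in A] D.
    move=> _ [_ [s sab <-]] [_ [t tab <-]] <-.
    by rewrite /= !in_itv/= in sab tab; exact: diam.
  have A0 : [set `|x - y| | x in A & y in A] 0.
    exists (g a); first exact: Aab.
    by exists (g a); [exact: Aab|rewrite subrr normr0].
  apply/andP; split; first by apply: ub_le_sup => //; exists D.
  by apply: ge_sup => //; exists 0.
have cgab : {within `[a, b], continuous g} by exact: continuous_subspaceT.
have : (qh_dist G (g a) (g b) < L%:E)%E.
  apply: (@le_lt_trans _ _ (psi (D / r))%:E); last by rewrite lte_fin.
  apply: (@le_trans _ _ (qh_diameter G A)).
    apply: ereal_sup_ubound; exists (g a); first exact: Aab.
    by exists (g b) => //; exact: Aab.
  apply: (@le_trans _ _ (psi (diameter A / dist A (bdry G)))%:E).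
    apply: nG.
    - by exists (g a); exact: Aab.
    - by apply: connected_continuous_connected => //; exact: segment_connected.
    - by move=> _ [t + <-]; rewrite /= in_itv/= => /Gg.
    - apply: compact_bounded; apply: continuous_compact => //.
      exact: segment_compact.
    - exact: lt_le_trans distA.
  have /andP[d0 dD] := diamA; have dist0 := lt_le_trans r0 distA.
  rewrite lee_fin; apply: psi_mono; first by rewrite divr_ge0// ltW.
  by apply: ler_pM => //; rewrite ?invr_ge0 ?(ltW dist0)// lef_pV2// posrE.
move=> /ereal_inf_lt[_ /= [h [a' [b' [[[ab' ch Gh ha hb] _ lh] ->]]]] /ltW hL].
have [lenh dh] := qh_length_bounds oG bG0 ab' ch Gh lh hL.
have [cp pE] := within_continuous_clamp ab' ch.
pose p (t : R) := t + a'.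
have shift t : 0 <= t <= b' - a' -> a' <= p t <= b'.
  by move=> /andP[t0 tb]; rewrite /p lerDr t0 -lerBrDr.
(* The arc is shifted so that its parameter starts at 0. *)
exists ((h \o clamp a' b') \o p), (b' - a'); split.
- by rewrite subr_ge0.
- move=> t; apply: (@continuous_comp _ _ _ p (h \o clamp a' b')); last exact: cp.
  by apply: cvgD; [exact: cvg_id|exact: cvg_cst].
- by rewrite /comp /p add0r -ha -[RHS]pE// lexx.
- by rewrite /comp /p subrK -hb -[RHS]pE// lexx andbT.
split.
  rewrite -ha; apply: le_trans lenh.
  apply: (le_trans (@length_comp_incr _ _ (h \o clamp a' b') p _ _ _)).
    by move=> u v uv; rewrite /p ltrD2r.
  by rewrite /p add0r subrK; apply: eq_length.
move=> t /shift tp; rewrite -ha; have -> : ((h \o clamp a' b') \o p) t = h (p t) by exact: pE.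
by split; [exact: Gh|exact: dh].
Qed.

End LengthCarrots.

(** * Length carrots *)

Section JohnCurves.
Context {R : realType} {E : completeNormedModType R}.
Implicit Types (G A : set E) (g h : R -> E) (a b m s t u r D K L l C : R).
Implicit Types (x y z : E).

(** [l] bounds the total length; it has to be tracked because it enters the
condition on every curve that continues this one. *)
Definition length_carrot G K x y l := exists g b,
  [/\ 0 <= b, continuous g, g 0 = x, g b = y &
    (curve_length g 0%R b <= l%:E)%E /\
    forall t, 0 <= t <= b -> G (g t) /\
      (curve_length g 0%R t <= (K * dist_bdry G (g t))%:E)%E].

Lemma length_carrot_refl G K x : G x -> 0 <= K * dist_bdry G x ->
  length_carrot G K x x 0.
Proof.
move=> Gx dx; exists (cst x), 0; split => //; first exact: cst_continuous.
split; first by rewrite length_refl.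
move=> t /andP[t0 t0']; have -> : t = 0 by apply/eqP; rewrite eq_le t0 t0'.
by rewrite length_refl lee_fin.
Qed.

Lemma length_carrot_le G K x y l l' : l <= l' ->
  length_carrot G K x y l -> length_carrot G K x y l'.
Proof.
move=> ll' [g [b [b0 cg g0 gb [lg gP]]]]; exists g, b; split => //; split => //.
by apply: le_trans lg _; rewrite lee_fin.
Qed.

(** On the added arc the length travelled is at most [l + r] and the boundary
distance is at least [d(y) / K], so the carrot condition persists there as soon
as [K * (l + r) <= K' * d(y)]. *)
Lemma length_carrot_extend G K K' x y z l r : 0 <= l -> 0 < K -> 0 <= K' ->
  K * (l + r) <= K' * dist_bdry G y -> K * dist_bdry G y <= r ->
  length_carrot G K' x y l -> short_arc G K y z ->
  length_carrot G K' x z (l + r).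
Proof.
move=> l0 K0 K'0 K'P rP [g [b [b0 cg g0 gb [lg gP]]]].
move=> [h [c [c0 ch h0 hc [lh hP]]]].
pose p t := t - b.
have cp : continuous (h \o p).
  move=> t; apply: (@continuous_comp _ _ _ p h); last exact: ch.
  by apply: cvgB; [exact: cvg_id|exact: cvg_cst].
have [|k [ck kg kh]] := @glue_curves _ _ _ _ b cg cp.
  by rewrite /comp /p subrr gb h0.
have lkg t : 0 <= t <= b -> (curve_length k 0%R t <= curve_length g 0%R t)%E.
  move=> /andP[t0 tb]; apply: eq_length => s /andP[_ st].
  by apply: kg; exact: le_trans tb.
have lkh t : b <= t <= b + c -> (curve_length k 0%R t <= (l + r)%:E)%E.
  move=> /andP[bt tc]; apply: le_trans (length_cat _ b0 bt) _.
  rewrite EFinD; apply: leeD.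
    by apply: le_trans (lkg b _) lg; rewrite b0 lexx.
  apply: (@le_trans _ _ (curve_length (h \o p) b t)).
    by apply: eq_length => s /andP[bs _]; exact: kh.
  apply: (le_trans (@length_comp_incr _ _ h p _ _ _)).
    by move=> u v uv; rewrite /p ltrD2r.
  rewrite /p subrr; apply: (@le_trans _ _ (curve_length h 0%R c)).
    by apply: length_ler; rewrite ?subr_ge0// lerBlDl.
  by apply: le_trans lh _; rewrite lee_fin.
exists k, (b + c); split.
- exact: addr_ge0.
- exact: ck.
- by rewrite kg.
- by rewrite kh ?lerDl// /comp /p addrAC subrr add0r.
split; first by apply: lkh; rewrite lerDl c0 lexx.
move=> t /andP[t0 tbc]; have [tb|/ltW bt] := leP t b.
  rewrite kg//; have [|Gt lt] := gP t; first by rewrite t0.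
  by split => //; apply: le_trans (lkg t _) lt; rewrite t0.
have [|Gt dt] := hP (p t).
  by rewrite /p subr_ge0 bt lerBlDl.
rewrite kh//; split => //; apply: (le_trans (lkh t _)); first by rewrite bt.
rewrite lee_fin -(ler_pM2l K0); apply: (le_trans K'P).
by rewrite mulrCA ler_wpM2l.
Qed.

Lemma last_crossing (h : R -> R) a t v : continuous h -> a <= t ->
  h a <= v -> v < h t ->
  exists s, [/\ a <= s <= t, h s = v & forall u, s <= u <= t -> v <= h u].
Proof.
move=> ch at_ hav vht.
pose S := `[a, t] `&` h @^-1` [set w | w <= v].
have Sa : S a by split => //; rewrite /= in_itv/= lexx.
have Sub : ubound S t by move=> u [+ _]; rewrite /= in_itv/= => /andP[].
have closedS : closed S.
  apply: closedI; first exact: itv_closed.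
  by apply: closed_comp; [move=> u _; exact: ch|exact: closed_le].
have [sat hs] : S (sup S).
  by apply: closedS; apply: closure_sup; [exists a|exists t].
rewrite /= in_itv/= in sat hs; have /andP[as_ st] := sat.
have after u : sup S < u <= t -> v < h u.
  move=> /andP[su ut]; rewrite ltNge; apply/negP => huv.
  move: (su); rewrite ltNge => /negP; apply; apply: ub_le_sup; first by exists t.
  by split => //; rewrite /= in_itv/= ut (le_trans as_)// ltW.
have st' : sup S < t.
  rewrite lt_neqAle st andbT; apply/eqP => E1.
  by move: vht; rewrite -E1 ltNge hs.
have hsv : v <= h (sup S).
  rewrite -subr_ge0.
  have [] // := @ge0_closure_itv _ (fun u => h u - v) _ _ _ st'.
    by move=> u; apply: cvgB; [exact: ch|exact: cvg_cst].
  by move=> u /andP[su ut]; rewrite subr_ge0 ltW// after// su ltW.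
exists (sup S); split => //; first by apply/eqP; rewrite eq_le hs.
move=> u /andP[]; rewrite le_eqVlt => /predU1P[<- _ //|su ut].
by rewrite ltW// after// su.
Qed.

End JohnCurves.

(** * From distance carrots to length carrots *)

Section Carrots.
Context {R : realType} {E : completeNormedModType R}.
Implicit Types (G A : set E) (g h : R -> E) (a b m s t u r D K L l C : R).
Implicit Types (x y z : E).

Definition distance_carrot G C g a m := forall s t, a <= s -> s <= t -> t <= m ->
  `|g s - g t| <= C * dist_bdry G (g t).

Lemma distance_carrot_diam G C g a m s t u : distance_carrot G C g a m ->
  a <= s <= u -> a <= t <= u -> u <= m ->
  `|g s - g t| <= 2 * C * dist_bdry G (g u).
Proof.
move=> gC /andP[as_ su] /andP[at_ tu] um.
apply: le_trans (ler_distD (g u) _ _) _; rewrite -mulrA mulr2n mulrDl mul1r.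
by apply: lerD; [exact: gC|rewrite distrC; exact: gC].
Qed.

(** By induction on [n], a point of boundary distance at most [2 ^ n * d] is
reached by a length carrot of total length at most [K * 2 ^ n * d]: an arc of
length [K * 2 ^ n * d] starting at the last point of boundary distance
[2 ^ n * d] doubles the bound. *)
Lemma distance_to_length_carrot (psi : R -> R) G g a m C L :
  increasing_halfline psi -> open G -> bdry G !=set0 -> natural psi G ->
  continuous g -> (forall t, G (g t)) -> 1 <= C -> a <= m ->
  distance_carrot G C g a m -> psi (4 * C * (1 + C)) < L ->
  exists l, length_carrot G (2 * expR L * expR L) (g a) (g m) l.
Proof.
move=> psiP oG bG0 nG cg Gg C1 am gC psiL.
set K := expR L; set K' := 2 * K * K; set d := dist_bdry G (g a).
have psi_mono := psiP.2; have psi0 := psiP.1.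
have dG t : 0 < dist_bdry G (g t) by exact: dist_bdry_gt0.
have d0 : 0 < d by exact: dG.
have K0 : 0 < K by exact: expR_gt0.
have K'0 : 0 < K' by rewrite !mulr_gt0.
have C0 : 0 < C by exact: lt_le_trans C1.
(* The bound covers the quotients 2 * C * (1 + C) of the first piece and 4 * C
   of the later ones. *)
have short s t r v : a <= s -> s <= t -> t <= m -> 0 < r ->
    (forall u, s <= u <= t -> r <= dist_bdry G (g u)) ->
    dist_bdry G (g t) <= v -> 2 * C * v / r <= 4 * C * (1 + C) ->
    short_arc G K (g s) (g t).
  move=> as_ st tm r0 rd dv vr.
  have v0 : 0 < v by exact: lt_le_trans (dG t) dv.
  apply: (natural_short_arc psiP oG bG0 nG st cg _ r0 rd (D := 2 * C * v)) => //.
    move=> u w /andP[su ut] /andP[sw wt].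
    apply: le_trans (distance_carrot_diam gC (u := t) _ _ tm) _.
    - by rewrite ut (le_trans as_).
    - by rewrite wt (le_trans as_).
    - by rewrite ler_pM2l// mulr_gt0.
  by apply: le_lt_trans psiL; apply: psi_mono => //; rewrite divr_ge0 ?mulr_ge0 ?ltW.
(* Up to boundary distance d the curve is one piece: the carrot condition keeps
   it at distance at least d / (1 + C) from the boundary. *)
have base t : a <= t -> t <= m -> dist_bdry G (g t) <= d ->
    length_carrot G K' (g a) (g t) (K * d).
  move=> at_ tm dt; rewrite -[K * d]add0r.
  have Cp : 0 < 1 + C by rewrite addr_gt0.
  apply: (length_carrot_extend (K := K) (y := g a)) => //; first exact: ltW.
  - by have := mulr_gt0 (mulr_gt0 K0 K0) d0; rewrite /K' -/d; lra.
  - by apply: length_carrot_refl => //; rewrite mulr_ge0 ?ltW.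
  - apply: (short _ _ (d / (1 + C)) d) => //; first by rewrite divr_gt0.
      move=> u /andP[au ut]; rewrite ler_pdivrMr//.
      apply: le_trans (dist_bdry_lip _ (g u) bG0) _.
      rewrite mulrDr mulr1 addrC lerD2l [leRHS]mulrC.
      by apply: gC => //; exact: le_trans tm.
    have -> : 2 * C * d / (d / (1 + C)) = 2 * C * (1 + C).
      by field; rewrite !gt_eqF.
    by rewrite ler_pM2r// ler_pM2r// ler_nat.
have levels n t : a <= t -> t <= m -> dist_bdry G (g t) <= 2 ^+ n * d ->
    length_carrot G K' (g a) (g t) (K * (2 ^+ n * d)).
  elim: n t => [|n IH] t at_ tm; first by rewrite expr0 mul1r; exact: base.
  set v := 2 ^+ n * d in IH *.
  have v0 : 0 < v by rewrite mulr_gt0// exprn_gt0.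
  have -> : 2 ^+ n.+1 * d = v + v by rewrite exprS /v; ring.
  rewrite mulrDr => dt; have [dtv|vdt] := leP (dist_bdry G (g t)) v.
    apply: length_carrot_le (IH t at_ tm dtv).
    by rewrite lerDl mulr_ge0 ?ltW.
  have [||s [/andP[as_ st] ds sd]] :=
      @last_crossing _ (fun t => dist_bdry G (g t)) _ _ v _ at_ _ vdt.
  - move=> u; apply: (@continuous_comp _ _ _ g (dist_bdry G)); first exact: cg.
    exact: dist_bdry_continuous.
  - by apply: ler_peMl; [exact: ltW|apply: exprn_ege1; rewrite ler1n].
  have sm : s <= m := le_trans st tm.
  apply: (length_carrot_extend (K := K) (y := g s)) => //.
  - by rewrite mulr_ge0 ?ltW.
  - exact: ltW.
  - by rewrite ds /K' le_eqVlt; apply/orP; left; apply/eqP; ring.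
  - by rewrite ds.
  - by apply: IH => //; rewrite ds.
  - apply: (short _ _ v (v + v)) => //.
    have -> : 2 * C * (v + v) / v = 4 * C * 1 by field; rewrite gt_eqF.
    by rewrite ler_pM2l ?mulr_gt0// lerDl ltW.
have [n dn] : exists n, dist_bdry G (g m) <= 2 ^+ n * d.
  have := archi_boundP (ltW (divr_gt0 (dG m) d0)); set n := Num.bound _ => nP.
  exists n; rewrite -ler_pdivrMr//; apply: (le_trans (ltW nP)).
  by rewrite -natrX ler_nat ltnW// ltn_expl.
by exists (K * (2 ^+ n * d)); exact: levels.
Qed.

(** The second carrot is run backwards, so that its length condition refers to
the end of the joined curve. *)
Lemma join_length_carrots G K x1 x2 y l1 l2 :
  length_carrot G K x1 y l1 -> length_carrot G K x2 y l2 ->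
  exists g a b, curve_in G g a b x1 x2 /\ forall t, a <= t <= b ->
    (Order.min (curve_length g a t) (curve_length g t b)
      <= (K * dist_bdry G (g t))%:E)%E.
Proof.
move=> [g [b [b0 cg g0 gb [_ gP]]]] [h [c [c0 ch h0 hc [_ hP]]]].
pose p t := b + c - t.
have cp : continuous (h \o p).
  move=> t; apply: (@continuous_comp _ _ _ p h); last exact: ch.
  by apply: cvgB; [exact: cvg_cst|exact: cvg_id].
have [|k [ck kg kh]] := @glue_curves _ _ _ _ b cg cp.
  by rewrite /comp /p addrAC subrr add0r gb hc.
have Gk t : 0 <= t <= b + c -> (t <= b /\ G (g t)) \/
    (b <= t /\ 0 <= p t <= c /\ G (h (p t))).
  move=> /andP[t0 tbc]; have [tb|/ltW bt] := leP t b; [left|right].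
    by split => //; have [|] := gP t => //; rewrite t0.
  have pt : 0 <= p t <= c by rewrite /p subr_ge0 tbc lerBlDr addrC lerD2l.
  by split => //; split => //; have [] := hP _ pt.
exists k, 0, (b + c); split.
  split; [exact: addr_ge0|exact: continuous_subspaceT| | |].
  - move=> t /Gk[[tb Gt]|[bt [_ Gt]]]; first by rewrite kg.
    by rewrite kh.
  - by rewrite kg.
  - by rewrite kh ?lerDl// /comp /p subrr.
move=> t tP; rewrite ge_min; have /andP[t0 tbc] := tP.
case: (Gk t tP) => [[tb _]|[bt [pt _]]]; apply/orP; [left|right].
  rewrite kg//; have [|_ lt] := gP t; first by rewrite t0.
  apply: le_trans lt; apply: eq_length => s /andP[_ st].
  by apply: kg; exact: le_trans tb.
rewrite kh//; have [_ lt] := hP _ pt; apply: le_trans lt.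
apply: (@le_trans _ _ (curve_length (h \o p) t (b + c))).
  by apply: eq_length => s /andP[ts _]; apply: kh; exact: le_trans ts.
apply: (le_trans (@length_comp_decr _ _ h p _ _ _)).
  by move=> u v uv; rewrite /p ltrD2l ltrN2.
by rewrite {1}/p subrr.
Qed.

(** The cut time [m] is the supremum of the times up to which the first subarc
is not the longer one. The conditions on distances hold on either side of [m]
and, being closed, extend to [m]. *)
Lemma John_distance_carrots c G x1 x2 : 0 <= c -> open G -> bdry G !=set0 ->
  John c G -> G x1 -> G x2 -> exists g a m b, [/\ a <= m <= b, continuous g,
    forall t, G (g t), g a = x1 & g b = x2] /\
    (distance_carrot G c g a m /\
     distance_carrot G c (g \o -%R) (- b) (- m)).
Proof.
move=> c0 oG bG0 JG G1 G2; have [g0 [a [b [[ab cg0 Gg0 ga gb] JP]]]] := JG _ _ G1 G2.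
have [cg gE] := within_continuous_clamp ab cg0.
set g := g0 \o clamp a b in cg gE.
have Gg t : G (g t) by apply: Gg0; exact: clamp_itv.
have near_end t : a <= t <= b ->
    (forall s, a <= s <= t -> `|g s - g t| <= c * dist_bdry G (g t)) /\
      (curve_length g0 a t <= curve_length g0 t b)%E \/
    (forall s, t <= s <= b -> `|g s - g t| <= c * dist_bdry G (g t)) /\
      (curve_length g0 t b < curve_length g0 a t)%E.
  move=> /[dup] tab /andP[a_t tb]; have := JP t tab.
  have [lt|lt] := leP (curve_length g0 a t) (curve_length g0 t b) => lc.
  - left; split => // s /andP[as_ st].
    rewrite !gE ?tab ?as_ ?(le_trans st)// -lee_fin; apply: le_trans lc.
    by rewrite distrC; exact: dist_le_length.
  - right; split => // s /andP[ts sb].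
    rewrite !gE ?tab ?sb ?(le_trans a_t)// -lee_fin; apply: le_trans lc.
    exact: dist_le_length.
pose T := [set t | a <= t <= b /\ (curve_length g0 a t <= curve_length g0 t b)%E].
have Ta : T a by split; rewrite ?lexx ?ab// length_refl length_ge0.
have Tub : ubound T b by move=> t [/andP[]].
have hsT : has_ubound T by exists b.
pose m := sup T.
have am : a <= m by exact: ub_le_sup.
have mb : m <= b by apply: ge_sup => //; exists a.
have slack s : continuous (fun t => c * dist_bdry G (g t) - `|g s - g t|).
  move=> t; apply: cvgB.
    apply: cvgM; first exact: cvg_cst.
    apply: (@continuous_comp _ _ _ g (dist_bdry G)); first exact: cg.
    exact: dist_bdry_continuous.
  by apply: cvg_norm; apply: cvgB; [exact: cvg_cst|exact: cg].
have dge0 t : 0 <= c * dist_bdry G (g t).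
  by rewrite mulr_ge0// ltW// dist_bdry_gt0.
exists g, a, m, b; split.
  by rewrite am mb; split => //; rewrite gE ?lexx ?ab.
split.
  have before s t : a <= s -> s <= t -> t < m ->
      `|g s - g t| <= c * dist_bdry G (g t).
    move=> as_ st tm; have tab : a <= t <= b.
      by rewrite (le_trans as_ st)/= (le_trans (ltW tm)).
    have /andP[a_t tb] := tab.
    case: (near_end t tab) => [[H _]|[_ lt]]; first by apply: H; rewrite as_.
    have [t' [/andP[at' tb'] lt'] tt'] := sup_gt (ex_intro _ a Ta) tm.
    have := lt_le_trans lt (length_ler g0 a_t (ltW tt')).
    move=> /lt_le_trans /(_ lt') /lt_le_trans.
    by move=> /(_ _ (length_lel g0 (ltW tt') tb')); rewrite ltxx.
  move=> s t as_ st; rewrite le_eqVlt => /predU1P[tm|]; last exact: before.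
  move: st; rewrite le_eqVlt => /predU1P[->|st].
    by rewrite subrr normr0.
  rewrite -subr_ge0; have [] // := ge0_closure_itv (slack s) st.
  by move=> u /andP[su ut]; rewrite subr_ge0 before ?(ltW su)// -tm.
have after s t : s <= b -> t <= s -> m < t ->
    `|g s - g t| <= c * dist_bdry G (g t).
  move=> sb ts mt; have tab : a <= t <= b.
    by rewrite (le_trans am (ltW mt)) (le_trans ts).
  case: (near_end t tab) => [[_ lt]|[H _]]; last by apply: H; rewrite ts.
  by move: mt; rewrite ltNge => /negP[]; exact: ub_le_sup.
move=> s' t'; rewrite /comp -[s']opprK -[t']opprK.
move: (- s') (- t') => s t; rewrite !lerN2 !opprK => sb ts.
rewrite le_eqVlt => /predU1P[mt|]; last exact: after.
move: ts; rewrite le_eqVlt => /predU1P[->|ts].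
  by rewrite subrr normr0.
rewrite -subr_ge0; have [] // := ge0_closure_itv (slack s) ts.
by move=> u /andP[tu us]; rewrite subr_ge0 after ?(ltW us)// mt.
Qed.

End Carrots.

(** * Relative quasisymmetry *)

Section RelativeQuasisymmetry.
Context {R : realType}.

Lemma homeo_halfline_bounded (eta : R -> R) (M : R) : homeo_halfline eta ->
  0 <= M -> exists2 H, 0 <= H & forall t, 0 <= t <= M -> eta t <= H.
Proof.
move=> [[eta_fun _ _] eta_cont _] M0.
have [|p] := @EVT_max R eta 0 M M0.
  apply: continuous_subspaceW eta_cont => t.
  by rewrite /= in_itv/= => /andP[].
rewrite in_itv/= => /andP[p0 _] pmax; exists (eta p); first exact: eta_fun.
by move=> t tM; apply: pmax; rewrite in_itv.
Qed.

Context {E E' : completeNormedModType R}.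
Implicit Types (G : set E) (f : E -> E').

Lemma bdry_homeo_surj G (G' : set E') f y :
  homeomorphism (closure G) (closure G') f -> f @` G = G' -> bdry G' y ->
  exists2 x, bdry G x & f x = y.
Proof.
move=> [[_ _ fsurj] _ _] fG [/fsurj [x cGx <-]] nG'.
by exists x => //; split => // Gx; apply: nG'; rewrite -fG; exists x.
Qed.

(** The hypothesis bounds [|u - b|] by [(c + 1) |x - b|] for every boundary point
[b], so the triple [(b, u, x)] has ratio at most [c + 1]. *)
Lemma quasisymmetric_dist_le eta G (G' : set E') f c H u x :
  quasisymmetric_rel eta (closure G) (bdry G) f ->
  homeomorphism (closure G) (closure G') f -> f @` G = G' ->
  bdry G' !=set0 -> 0 <= H -> (forall t, 0 <= t <= c + 1 -> eta t <= H) ->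
  0 <= c -> G u -> G x -> `|u - x| <= c * dist_bdry G x ->
  `|f u - f x| <= (1 + H) * dist_bdry G' (f x).
Proof.
move=> [_ qs] hf fG bG'0 H0 etaH c0 Gu Gx ux.
rewrite mulrC -ler_pdivrMr ?ltr_wpDr//; apply: dist_bdry_ge => // z bz.
have [b bb fb] := bdry_homeo_surj hf fG bz.
have [cb nGb] := bb; have [_ nG'z] := bz.
have xb0 : 0 < `|x - b|.
  by rewrite normr_gt0 subr_eq0; apply/eqP => xb; apply: nGb; rewrite -xb.
have fxz0 : 0 < `|f x - z|.
  rewrite normr_gt0 subr_eq0; apply/eqP => fxz; apply: nG'z.
  by rewrite -fxz -fG; exists x.
rewrite ler_pdivrMr ?ltr_wpDr//.
have [->|/eqP neq] := eqVneq u x.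
  by rewrite subrr normr0 mulr_ge0// addr_ge0.
suff fuz : `|f u - z| <= H * `|f x - z|.
  apply: le_trans (ler_distD z _ _) _; rewrite [`|z - f x|]distrC.
  by rewrite mulrDr mulr1 addrC lerD2l mulrC.
rewrite -ler_pdivrMr//; apply: (@le_trans _ _ (eta (Defs.ratio b u x))).
  rewrite -fb; apply: qs; split; first by split => //; exact: subset_closure.
  split; last by left.
  by split => // bE; apply: nGb; rewrite bE.
apply: etaH; rewrite /Defs.ratio divr_ge0//= ler_pdivrMr//.
apply: le_trans (ler_distD x _ _) _; rewrite mulrDl mul1r lerD2r.
by apply: le_trans ux _; rewrite ler_wpM2l// dist_bdry_le.
Qed.

End RelativeQuasisymmetry.

(** * Images of John domains *)

Theorem corollary1p15 (R : realType) (c : R) (eta psi : R -> R) :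
  1 <= c -> homeo_halfline eta -> increasing_halfline psi ->
  exists c' : R, 1 <= c' /\
    forall (E E' : completeNormedModType R) (G : set E) (G' : set E')
      (f : E -> E'),
      dim_ge2 E -> dim_ge2 E' ->
      domain G -> G != setT ->
      domain G' -> G' != setT ->
      John c G ->
      homeomorphism (closure G) (closure G') f ->
      quasisymmetric_rel eta (closure G) (bdry G) f ->
      f @` G = G' ->
      natural psi G' ->
      John c' G'.
Proof.
move=> c1 eta_homeo psiP; have c0 : 0 <= c := le_trans ler01 c1.
have [|H H0 etaH] := homeo_halfline_bounded eta_homeo (_ : 0 <= c + 1).
  exact: addr_ge0.
pose C := 1 + H; have C1 : 1 <= C by rewrite lerDl.
have C0 : 0 <= C := le_trans ler01 C1.
pose L := psi (4 * C * (1 + C)) + 1; pose K := expR L.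
have L0 : 0 <= L by rewrite addr_ge0// psiP.1// !mulr_ge0// addr_ge0.
have psiL : psi (4 * C * (1 + C)) < L by rewrite ltrDl.
have K1 : 1 <= K by rewrite -expR0 ler_expR.
exists (2 * K * K); split; first by have := mulr_ege1 K1 K1; lra.
move=> E E' G G' f _ _ [oG _] GT [oG' _] G'T JG hf qs fG nG' y1 y2.
rewrite -fG => -[x1 G1 <-] [x2 G2 <-]; rewrite fG.
have bG0 : bdry G !=set0 by apply: bdry_neq0 => //; exists x1.
have bG'0 : bdry G' !=set0.
  by apply: bdry_neq0 => //; exists (f x1); rewrite -fG; exists x1.
have [g [a [m [b [[/andP[am mb] cg Gg ga gb] [gl gr]]]]]] :=
  John_distance_carrots c0 oG bG0 JG G1 G2.
have cfg : continuous (f \o g).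
  apply: (comp_within_continuous (A := closure G)) cg _; first by case: hf.
  by move=> t; exact: subset_closure.
have Gfg t : G' ((f \o g) t) by rewrite -fG; exists (g t).
have image_carrot (h : R -> E) s t : (forall u, G (h u)) ->
    distance_carrot G c h s t -> distance_carrot G' C (f \o h) s t.
  move=> Gh hc u v su uv vt.
  by apply: (quasisymmetric_dist_le (c := c) qs hf fG) => //; exact: hc.
have [l1] := distance_to_length_carrot psiP oG' bG'0 nG' cfg Gfg C1 am
  (image_carrot _ _ _ Gg gl) psiL.
have cfgN : continuous ((f \o g) \o -%R).
  by move=> t; apply: continuous_comp; [exact: oppr_continuous|exact: cfg].
have NbNm : - b <= - m by rewrite lerN2.
have [l2] := distance_to_length_carrot psiP oG' bG'0 nG' cfgN
  (fun t => Gfg (- t)) C1 NbNm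
  (image_carrot _ _ _ (fun t => Gg (- t)) gr) psiL.
rewrite /= !opprK ga gb => carrot2 carrot1.
exact: join_length_carrots carrot1 carrot2.
Qed.
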